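(* Let $\mathcal{H}$ be a countably generated Hilbert $\mathcal{A}$-module over a unital $C^*$-algebra $\mathcal{A}$. Let $\mathcal{T}$ be a compact self-adjoint operator on $\mathcal{H}$ of the form $$\mathcal{T}=\sum_{k=1}^{\infty}\alpha_k\langle\cdot,e_k\rangle e_k,$$ where $\{e_k\}_{k=1}^{\infty}$ is an orthonormal basis for $\mathcal{H}$ consisting of eigenvectors of $\mathcal{T}$ and the $\alpha_k$ are real scalars. Let $\{f_k\}_{k=1}^{\infty}$ be a Bessel sequence in $\mathcal{H}$ such that, for some $\xi>0$, the operator $S$ given by $Sf=\sum_{k=1}^{\infty}\langle f,f_k\rangle f_k$ satisfies $S=\mathcal{T}+\xi I$. Assume that $$\alpha:=\inf_k\alpha_k+\xi>0.$$ Then $\{f_k\}_{k=1}^{\infty}$ is a frame for $\mathcal{H}$.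
   Context: Hilbert $\mathcal{A}$-modules are left modules with an $\mathcal{A}$-valued inner product $\langle\cdot,\cdot\rangle$ that is $\mathcal{A}$-linear in the first variable and satisfies $\langle x,y\rangle=\langle y,x\rangle^*$; the norm is $\|x\|=\|\langle x,x\rangle\|^{1/2}$. Inequalities between elements of $\mathcal{A}$ are in the order of self-adjoint elements of $\mathcal{A}$, and series are understood to converge in norm (those defining operators, pointwise). A sequence $\{f_k\}_{k=1}^\infty$ in $\mathcal{H}$ is a Bessel sequence if there is $B>0$ with $\sum_{k}\langle f,f_k\rangle\langle f_k,f\rangle\le B\langle f,f\rangle$ for all $f\in\mathcal{H}$. It is a frame if there are $A,B>0$ with $A\langle f,f\rangle\le\sum_{k}\langle f,f_k\rangle\langle f_k,f\rangle\le B\langle f,f\rangle$ for all $f\in\mathcal{H}$. An orthonormal basis $\{e_k\}_{k=1}^\infty$ satisfies $\langle e_j,e_k\rangle=\delta_{jk}1_{\mathcal{A}}$ and $f=\sum_k\langle f,e_k\rangle e_k$ for all $f\in\mathcal{H}$. Compact operators on $\mathcal{H}$ are the elements of the norm closure of the linear span of the operators $f\mapsto\langle f,x\rangle y$, $x,y\in\mathcal{H}$. $I$ is the identity operator. *)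

(* Defs.v *)
From HB Require Import structures.
From mathcomp Require Import all_boot all_order all_algebra.
From mathcomp Require Import all_classical all_reals all_analysis.
From mathcomp Require Import complex.

Set Implicit Arguments.
Unset Strict Implicit.
Unset Printing Implicit Defensive.

Import Order.TTheory GRing.Theory Num.Theory.
Import numFieldNormedType.Exports.

Local Open Scope classical_set_scope.
Local Open Scope ring_scope.
Local Open Scope complex_scope.

(* MathComp-Analysis has no structure that is both a normed module and a
   noncommutative ring, nor a normed space that is at the same time a module
   over a ring other than its field of scalars. The norms below are therefore
   carried explicitly, as R-valued functions, and limits are taken for them. *)
Definition norm_cvg (R : realType) (V : zmodType) (nrm : V -> R)
    (u : nat -> V) (l : V) : Prop :=
  (fun n => nrm (u n - l)) @ \oo --> (0 : R).

Definition norm_cauchy (R : realType) (V : zmodType) (nrm : V -> R)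
    (u : nat -> V) : Prop :=
  forall eps : R, 0 < eps ->
    exists N : nat, forall m n, (N <= m)%N -> (N <= n)%N ->
      nrm (u m - u n) < eps.

Definition norm_complete (R : realType) (V : zmodType) (nrm : V -> R) : Prop :=
  forall u : nat -> V, norm_cauchy nrm u -> exists l : V, norm_cvg nrm u l.

HB.mixin Record Algebra_isCStar (R : realType) A & GRing.Algebra R[i] A := {
  cnorm : A -> R ;
  cnorm0_eq0 : forall a : A, cnorm a = 0 -> a = 0 ;
  cnormD : forall a b : A, cnorm (a + b) <= cnorm a + cnorm b ;
  cnormZ : forall (c : R[i]) (a : A), cnorm (c *: a) = Normc.normc c * cnorm a ;
  cnormM : forall a b : A, cnorm (a * b) <= cnorm a * cnorm b ;
  cnorm_complete : norm_complete cnorm ;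
  star : A -> A ;
  starK : involutive star ;
  starD : {morph star : a b / a + b} ;
  starZ : forall (c : R[i]) (a : A), star (c *: a) = conjc c *: star a ;
  starM : forall a b : A, star (a * b) = star b * star a ;
  cnorm_starM : forall a : A, cnorm (star a * a) = cnorm a ^+ 2
}.

#[short(type="cstarAlgType")]
HB.structure Definition CStarAlgebra (R : realType) :=
  { A of GRing.Algebra R[i] A & Algebra_isCStar R A }.

Section CStarOrder.
Variables (R : realType) (A : cstarAlgType R).
Implicit Types a b : A.

Definition selfadj a : Prop := star a = a.

Definition cspos a : Prop := exists c : A, a = star c * c.

Definition csle a b : Prop := [/\ selfadj a, selfadj b & cspos (b - a)].

End CStarOrder.

(* Only the A-module structure of H is recorded: A being unital, the complex
   scalars act on H through c |-> c%:A, see [hscale] below. The norm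
   is the one of the inner product; its triangle inequality, a consequence of
   the Cauchy-Schwarz inequality, is recorded in the structure. *)
HB.mixin Record Lmodule_isHilbert (R : realType) (A : cstarAlgType R) H
    & GRing.Lmodule A H := {
  inner : H -> H -> A ;
  innerDl : forall x y z : H, inner (x + y) z = inner x z + inner y z ;
  innerZl : forall (a : A) (x y : H), inner (a *: x) y = a * inner x y ;
  inner_star : forall x y : H, inner x y = star (inner y x) ;
  inner_pos : forall x : H, cspos (inner x x) ;
  hnorm : H -> R ;
  hnormE : forall x : H, hnorm x = Num.sqrt (cnorm (inner x x)) ;
  hnorm0_eq0 : forall x : H, hnorm x = 0 -> x = 0 ;
  hnormD : forall x y : H, hnorm (x + y) <= hnorm x + hnorm y ;
  hnorm_complete : norm_complete hnorm
}.

#[short(type="hilbertModType")]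
HB.structure Definition HilbertModule (R : realType) (A : cstarAlgType R) :=
  { H of GRing.Lmodule A H & Lmodule_isHilbert R A H }.

Section HilbertModuleTheory.
Variables (R : realType) (A : cstarAlgType R) (H : hilbertModType A).
Implicit Types (x y f : H) (g e : nat -> H) (T : H -> H).

Definition hscale (c : R[i]) x : H := (c%:A : A) *: x.

Definition series_to (u : nat -> H) x : Prop :=
  norm_cvg (@hnorm R A H) (series u) x.

Definition countably_generated : Prop :=
  exists g : nat -> H, forall x (eps : R), 0 < eps ->
    exists (n : nat) (a : nat -> A),
      hnorm (x - \sum_(0 <= k < n) a k *: g k) < eps.

Definition orthonormal_basis e : Prop :=
  (forall j k, inner (e j) (e k) = (j == k)%:R) /\
  (forall f, series_to (fun k => inner f (e k) *: e k) f).

Definition gram_sum g f (s : A) : Prop :=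
  norm_cvg (@cnorm R A) (series (fun k => inner f (g k) * inner (g k) f)) s.

Definition bessel_seq g : Prop :=
  exists2 B : R, 0 < B & forall f,
    exists2 s : A, gram_sum g f s & csle s (B%:C *: inner f f).

Definition frame g : Prop :=
  exists A0 B : R, [/\ 0 < A0, 0 < B & forall f,
    exists s : A, [/\ gram_sum g f s,
      csle (A0%:C *: inner f f) s & csle s (B%:C *: inner f f)]].

Definition selfadj_op T : Prop :=
  forall x y, inner (T x) y = inner x (T y).

Definition eigenvector T x : Prop :=
  x <> 0 /\ exists c : R[i], T x = hscale c x.

Definition rank_one x y : H -> H := fun f => inner f x *: y.

Definition rank_one_span (F : H -> H) : Prop :=
  exists (n : nat) (c : nat -> R[i]) (x y : nat -> H),
    forall f, F f = \sum_(0 <= k < n) hscale (c k) (rank_one (x k) (y k) f).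

(* Closure for the operator norm: the last inequality says that the operator
   norm of T - F is at most eps. *)
Definition compact_op T : Prop :=
  forall eps : R, 0 < eps ->
    exists2 F : H -> H, rank_one_span F &
      forall f, hnorm (T f - F f) <= eps * hnorm f.

End HilbertModuleTheory.

Arguments countably_generated {R A} H.

(* Main.v *)
(* Pairing the series of S with f gives the Gram sum s = <Sf, f>, so that
   s - alpha <f, f> = <Tf - mf, f> with m = inf alpha_k. The eigenvalues are
   bounded because T is, hence Rf = sum_k sqrt(alpha_k - m) <f, e_k> e_k is
   defined, and <Tf - mf, f> = <Rf, Rf>, which is positive as the inner square
   of a vector; no closure property of the cone of positive elements of the
   C*-algebra is needed. *)
Require Import Defs.
From mathcomp Require Import all_boot all_order all_algebra.
From mathcomp Require Import all_classical all_reals all_analysis.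
From mathcomp Require Import complex ring lra.

Set Implicit Arguments.
Unset Strict Implicit.

Import Order.TTheory GRing.Theory Num.Theory.
Import numFieldNormedType.Exports.

Local Open Scope classical_set_scope.
Local Open Scope ring_scope.
Local Open Scope complex_scope.

(** * Elementary facts on the norm of a C*-algebra *)

Section CStarNorm.
Variables (R : realType) (A : cstarAlgType R).
Implicit Types a b : A.

Lemma normc_real (r : R) : Normc.normc r%:C = `|r|.
Proof. by rewrite /= expr0n addr0 sqrtr_sqr. Qed.

Lemma cnorm0 : cnorm (0 : A) = 0.
Proof. by rewrite -(scale0r (0 : A)) cnormZ Normc.normc0 mul0r. Qed.

Lemma cnormN a : cnorm (- a) = cnorm a.
Proof.
have -> : - a = (-1)%:C *: a by rewrite rmorphN rmorph1 scaleN1r.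
by rewrite cnormZ normc_real normrN1 mul1r.
Qed.

Lemma cnorm_ge0 a : 0 <= cnorm a.
Proof. by have := cnormD a (- a); rewrite subrr cnorm0 cnormN; lra. Qed.

(** The C*-identity and submultiplicativity give ‖b‖² ≤ ‖b*‖ ‖b‖; cancelling ‖b‖ and using the
    result for both [a] and [star a] yields equality. *)
Lemma cnorm_star a : cnorm (star a) = cnorm a.
Proof.
suff le_star b : cnorm b <= cnorm (star b).
  by apply/eqP; rewrite eq_le le_star -{2}[a]starK le_star.
have := cnorm_ge0 b; rewrite le_eqVlt => /predU1P[<-|b_gt0].
  exact: cnorm_ge0.
rewrite -(ler_pM2r b_gt0) -expr2 -cnorm_starM; exact: cnormM.
Qed.

Lemma cnorm1 : cnorm (1 : A) = 1.
Proof.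
have star1 : star 1 = 1 :> A by rewrite -[LHS]mulr1 -{2}[1]starK -starM mulr1 starK.
have := cnorm_starM (1 : A); rewrite star1 mulr1 => /eqP.
rewrite expr2 -{1}[cnorm 1]mulr1 (inj_eq (mulfI _)) => [/eqP<-//|].
by apply: contra_neq (oner_neq0 A) => /cnorm0_eq0.
Qed.

End CStarNorm.

(** * Limits for a norm carried as a function *)

Section NormCvg.
Variable R : realType.

(** Stated for an arbitrary [nrm], so that it serves both [cnorm] on [A] and [hnorm] on [H]. *)
Lemma norm_cvg_unique (V : zmodType) (nrm : V -> R)
    (nrm_ge0 : forall x, 0 <= nrm x) (nrm0 : forall x, nrm x = 0 -> x = 0)
    (nrmN : forall x, nrm (- x) = nrm x)
    (nrmD : forall x y, nrm (x + y) <= nrm x + nrm y) (u : nat -> V) l l' :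
  norm_cvg nrm u l -> norm_cvg nrm u l' -> l = l'.
Proof.
move=> ul ul'; apply/eqP; rewrite -subr_eq0; apply/eqP/nrm0/eqP.
rewrite eq_le nrm_ge0 andbT.
have : nrm (u n - l) + nrm (u n - l') @[n --> \oo] --> (0 + 0 : R).
  exact: cvgD.
rewrite addr0 => /cvgr_to_ge; apply.
apply: nearW => n; rewrite -[nrm (u n - l)]nrmN opprB.
by have := nrmD (l - u n) (u n - l'); rewrite addrA subrK.
Qed.

Lemma norm_cvg_squeeze (V : zmodType) (nrm : V -> R)
    (nrm_ge0 : forall x, 0 <= nrm x) (u : nat -> V) l (v : nat -> R) :
  (forall n, nrm (u n - l) <= v n) -> v @ \oo --> (0 : R) -> norm_cvg nrm u l.
Proof.
move=> uv v0; apply: squeeze_cvgr (cvg_cst _) v0.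
by apply: nearW => n; rewrite nrm_ge0 uv.
Qed.

End NormCvg.

(** * Sesquilinearity of the inner product and the module norm *)

Section HilbertNorm.
Variables (R : realType) (A : cstarAlgType R) (H : hilbertModType A).
Implicit Types x y z f : H.

Lemma innerDr x y z : inner x (y + z) = inner x y + inner x z.
Proof. by rewrite inner_star innerDl starD -!inner_star. Qed.

Lemma innerZr (a : A) x y : inner x (a *: y) = inner x y * star a.
Proof. by rewrite inner_star innerZl starM -inner_star. Qed.

Lemma inner0l y : inner 0 y = 0.
Proof. by rewrite -(scale0r (0 : H)) innerZl mul0r. Qed.

Lemma inner_suml (I : Type) (r : seq I) (F : I -> H) y :
  inner (\sum_(i <- r) F i) y = \sum_(i <- r) inner (F i) y.
Proof.
by elim/big_rec2: _ => [|i _ x _ <-]; rewrite ?inner0l ?innerDl.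
Qed.

Lemma innerNl x y : inner (- x) y = - inner x y.
Proof. by rewrite -scaleN1r innerZl mulN1r. Qed.

Lemma innerBl x y z : inner (x - y) z = inner x z - inner y z.
Proof. by rewrite innerDl innerNl. Qed.

Lemma innerNr x y : inner x (- y) = - inner x y.
Proof.
by apply/eqP; rewrite -addr_eq0 -innerDr addNr inner_star inner0l
  -(inner0l 0) -inner_star inner0l.
Qed.

Lemma innerBr x y z : inner x (y - z) = inner x y - inner x z.
Proof. by rewrite innerDr innerNr. Qed.

Lemma inner_hscalel (c : R[i]) x y : inner (hscale c x) y = c *: inner x y.
Proof. by rewrite innerZl mulr_algl. Qed.

Lemma inner_hscaler (c : R[i]) x y : inner x (hscale c y) = c^*%C *: inner x y.
Proof. by rewrite inner_star inner_hscalel starZ -inner_star. Qed.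

Lemma hnorm_ge0 x : 0 <= hnorm x.
Proof. by rewrite hnormE sqrtr_ge0. Qed.

Lemma sqr_hnorm x : hnorm x ^+ 2 = cnorm (inner x x).
Proof. by rewrite hnormE sqr_sqrtr ?cnorm_ge0. Qed.

Lemma hnorm_proportional (c : R) x y : 0 <= c ->
  inner x x = (c ^+ 2)%:C *: inner y y -> hnorm x = c * hnorm y.
Proof.
move=> c_ge0 xy; rewrite !hnormE xy cnormZ normc_real ger0_norm ?sqr_ge0 //.
by rewrite sqrtrM ?sqr_ge0 // sqrtr_sqr ger0_norm.
Qed.

Lemma hnorm_hscale (c : R) x : hnorm (hscale c%:C x) = `|c| * hnorm x.
Proof.
apply: hnorm_proportional => //.
by rewrite inner_hscalel inner_hscaler conjc_real scalerA -rmorphM real_normK ?num_real.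
Qed.

Lemma hnormN x : hnorm (- x) = hnorm x.
Proof. by rewrite !hnormE innerNl innerNr opprK. Qed.

Lemma hnorm0 : hnorm (0 : H) = 0.
Proof. by rewrite hnormE inner0l cnorm0 sqrtr0. Qed.

Lemma hnormB x y : hnorm (x - y) <= hnorm x + hnorm y.
Proof. by rewrite -[hnorm y]hnormN Defs.hnormD. Qed.

(** Follows from ⟨ax, ax⟩ = a ⟨x, x⟩ a* and ‖a*‖ = ‖a‖, after squaring. *)
Lemma hnorm_scale_le (a : A) x : hnorm (a *: x) <= cnorm a * hnorm x.
Proof.
rewrite -[leLHS]ger0_norm ?hnorm_ge0 // -sqrtr_sqr.
rewrite -[leRHS]ger0_norm ?mulr_ge0 ?cnorm_ge0 ?hnorm_ge0 // -sqrtr_sqr.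
apply: ler_wsqrtr; rewrite exprMn !sqr_hnorm innerZl innerZr mulrA expr2.
apply: le_trans (cnormM _ _) _; rewrite cnorm_star mulrAC.
by apply: ler_wpM2r; rewrite ?cnorm_ge0 // cnormM.
Qed.

(** * Polarization and a Cauchy-Schwarz bound up to a constant *)

Lemma inner_addsub x y :
  inner (x + y) (x + y) - inner (x - y) (x - y) = (inner x y + inner y x) *+ 2.
Proof.
rewrite !innerDl !innerDr !innerNl !innerNr opprK.
move: (inner x x) (inner x y) (inner y x) (inner y y) => a b c d.
rewrite (_ : a + b + (c + d) = (a + d) + (b + c)); last by rewrite [c + d]addrC addrACA.
rewrite (_ : a - b + (- c + d) = (a + d) - (b + c)).
  by rewrite opprB [LHS]addrC addrA subrK mulr2n.
by rewrite [- c + d]addrC addrACA opprD.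
Qed.

(** The first difference is 2(⟨x,y⟩ + ⟨y,x⟩); the second, multiplied by i, is 2(⟨x,y⟩ - ⟨y,x⟩), so
    ⟨y,x⟩ cancels. *)
Lemma polarization x y :
  4%:R *: inner x y =
    (inner (x + y) (x + y) - inner (x - y) (x - y)) +
    'i *: (inner (x + hscale 'i y) (x + hscale 'i y)
           - inner (x - hscale 'i y) (x - hscale 'i y)).
Proof.
rewrite !inner_addsub inner_hscalel inner_hscaler [_^*%C]conjCi -scalerMnr.
rewrite scalerDr !scalerA mulrN -expr2 sqrCi opprK scale1r scaleN1r.
by rewrite -mulrnDl addrACA subrr addr0 -mulr2n -mulrnA scaler_nat.
Qed.

(** Each of the four inner squares in [polarization] has norm at most (‖x‖ + ‖y‖)², since
    multiplying [y] by i preserves its norm. *)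
Lemma cnorm_inner_le_sqr x y : cnorm (inner x y) <= (hnorm x + hnorm y) ^+ 2.
Proof.
have norm_i z : hnorm (hscale 'i z) = hnorm z.
  rewrite -[RHS]mul1r; apply: hnorm_proportional => //.
  by rewrite inner_hscalel inner_hscaler scalerA [_^*%C]conjCi mulrN -expr2 sqr_i opprK expr1n.
have q (z z' : H) : hnorm z <= hnorm x + hnorm y -> hnorm z' <= hnorm x + hnorm y ->
    cnorm (inner z z - inner z' z') <= 2 * (hnorm x + hnorm y) ^+ 2.
  move=> lez lez'; apply: le_trans (cnormD _ _) _; rewrite cnormN -!sqr_hnorm.
  have nz := hnorm_ge0 z; have nz' := hnorm_ge0 z'; nra.
have := congr1 (@cnorm R A) (polarization x y); rewrite cnormZ.
rewrite -[4%:R](rmorph_nat (real_complex R)) normc_real ger0_norm //.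
set p := _ - inner (x - y) _; set r := _ - inner (x - hscale _ _) _ => pr.
have := cnormD p ('i *: r).
rewrite cnormZ [Normc.normc 'i](_ : _ = 1); last first.
  by rewrite /= expr0n add0r expr1n sqrtr1.
rewrite -pr mul1r.
have : cnorm p <= 2 * (hnorm x + hnorm y) ^+ 2 by rewrite q ?Defs.hnormD ?hnormB.
have : cnorm r <= 2 * (hnorm x + hnorm y) ^+ 2.
  by rewrite q // -(norm_i y) ?Defs.hnormD ?hnormB.
by lra.
Qed.

(* The sharp constant is 1; polarization and the triangle inequality give 4
   without any use of the order of the C*-algebra. *)
Lemma cnorm_inner_le x y : cnorm (inner x y) <= 4 * hnorm x * hnorm y.
Proof.
have := hnorm_ge0 x; rewrite le_eqVlt => /predU1P[/esym/hnorm0_eq0->|x_gt0].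
  by rewrite inner0l cnorm0 hnorm0 mulr0 mul0r.
have := hnorm_ge0 y; rewrite le_eqVlt => /predU1P[/esym/hnorm0_eq0->|y_gt0].
  by rewrite inner_star cnorm_star inner0l cnorm0 hnorm0 mulr0.
(* Both vectors are normalized, so the previous bound becomes (1 + 1)². *)
have := cnorm_inner_le_sqr (hscale (hnorm x)^-1%:C x) (hscale (hnorm y)^-1%:C y).
rewrite inner_hscalel inner_hscaler conjc_real !cnormZ !normc_real.
rewrite !hnorm_hscale !ger0_norm ?invr_ge0 ?hnorm_ge0 // !mulVf ?gt_eqF //.
rewrite mulrA -invfM mulrC ler_pdivrMr ?mulr_gt0 //.
by rewrite (_ : (1 + 1) ^+ 2 = 4) ?mulrA //; ring.
Qed.

(** * Limits, series and bounded operators in the module *)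

Lemma hnorm_cvg_unique (u : nat -> H) x y :
  norm_cvg (@hnorm R A H) u x -> norm_cvg (@hnorm R A H) u y -> x = y.
Proof.
by apply: norm_cvg_unique;
  [exact: hnorm_ge0|exact: hnorm0_eq0|exact: hnormN|exact: Defs.hnormD].
Qed.

Lemma cnorm_cvg_unique (u : nat -> A) a b :
  norm_cvg (@cnorm R A) u a -> norm_cvg (@cnorm R A) u b -> a = b.
Proof.
by apply: norm_cvg_unique;
  [exact: cnorm_ge0|exact: cnorm0_eq0|exact: cnormN|exact: cnormD].
Qed.

Lemma inner_cvg (u v : nat -> H) x y :
  norm_cvg (@hnorm R A H) u x -> norm_cvg (@hnorm R A H) v y ->
  norm_cvg (@cnorm R A) (fun n => inner (u n) (v n)) (inner x y).
Proof.
move=> ux vy.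
apply: (@norm_cvg_squeeze _ _ _ (@cnorm_ge0 R A) _ _ (fun n =>
  4 * hnorm (u n - x) * (hnorm (v n - y) + hnorm y) +
  4 * hnorm x * hnorm (v n - y))).
  move=> n; have -> : inner (u n) (v n) - inner x y =
      inner (u n - x) (v n) + inner x (v n - y).
    by rewrite innerBl innerBr addrA subrK.
  apply: le_trans (cnormD _ _) _; apply: lerD; last exact: cnorm_inner_le.
  apply: le_trans (cnorm_inner_le _ _) _.
  apply: ler_wpM2l; first by rewrite mulr_ge0 ?hnorm_ge0.
  (* ‖v n‖ varies with n; it is replaced by ‖v n - y‖ + ‖y‖, whose limit is known. *)
  by rewrite -{1}[v n](subrK y) Defs.hnormD.
have -> : 0 = 4 * 0 * (0 + hnorm y) + 4 * hnorm x * 0 :> R by ring.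
apply: cvgD; apply: cvgM => //; first by apply: cvgM => //; exact: cvg_cst.
  by apply: cvgD => //; exact: cvg_cst.
exact: cvg_cst.
Qed.

Lemma hnorm_cvg_cst x : norm_cvg (@hnorm R A H) (fun=> x) x.
Proof. by rewrite /norm_cvg subrr hnorm0; exact: cvg_cst. Qed.

Lemma hnorm_cvgB_hscale (c : R) (u v : nat -> H) x y :
  norm_cvg (@hnorm R A H) u x -> norm_cvg (@hnorm R A H) v y ->
  norm_cvg (@hnorm R A H) (fun n => u n - hscale c%:C (v n))
    (x - hscale c%:C y).
Proof.
move=> ux vy; apply: (@norm_cvg_squeeze _ _ _ hnorm_ge0 _ _ (fun n =>
  hnorm (u n - x) + `|c| * hnorm (v n - y))).
  move=> n; rewrite -hnorm_hscale [hscale _ (_ - _)]scalerBr -/(hscale _ _).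
  apply: le_trans (hnormB _ _); rewrite le_eqVlt; apply/orP; left; apply/eqP.
  by congr hnorm; rewrite !opprD !opprK addrACA.
by have := cvgD ux (cvgM (cvg_cst `|c|) vy); rewrite mulr0 addr0; apply.
Qed.

Lemma series_cvg_cauchy (u : nat -> H) x : series_to u x ->
  forall eps : R, 0 < eps ->
    exists N, forall m n, (N <= m)%N -> (m <= n)%N ->
      hnorm (\sum_(m <= k < n) u k) < eps.
Proof.
move=> ux eps eps_gt0.
have /cvgr_lt/(_ (eps / 2)) := ux; rewrite divr_gt0 // => /(_ isT)[N _ le_N].
exists N => m n Nm mn; rewrite -sub_series_geq //.
have := hnormB (series u n - x) (series u m - x).
rewrite opprB addrA subrK => /le_lt_trans; apply.
by rewrite [eps]splitr ltrD ?le_N //= (leq_trans Nm).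
Qed.

Lemma series_to_complete (u : nat -> H) :
  (forall eps : R, 0 < eps ->
    exists N, forall m n, (N <= m)%N -> (m <= n)%N ->
      hnorm (\sum_(m <= k < n) u k) < eps) ->
  exists x, series_to u x.
Proof.
move=> cu; apply: hnorm_complete => eps /cu[N hN]; exists N => m n Nm Nn.
case: (leqP m n) => [mn|/ltnW nm]; last by rewrite sub_series_geq ?hN.
by rewrite -hnormN opprB sub_series_geq ?hN.
Qed.

(** One finite-rank [F] within operator distance 1 of [T] suffices: each rank-one term of [F] is
    bounded by [cnorm_inner_le]. *)
Lemma compact_op_bounded (T : H -> H) : compact_op T ->
  exists2 C : R, 0 <= C & forall f, hnorm (T f) <= C * hnorm f.
Proof.
move=> /(_ 1 ltr01)[F [n [c [x [y FE]]]] TF].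
exists (1 + \sum_(0 <= k < n) cnorm ((c k)%:A : A) * (4 * hnorm (x k) * hnorm (y k))).
  rewrite addr_ge0 // sumr_ge0 // => k _.
  by rewrite !mulr_ge0 ?cnorm_ge0 ?hnorm_ge0.
move=> f; rewrite -[T f](subrK (F f)); apply: le_trans (Defs.hnormD _ _) _.
rewrite mulrDl lerD // {}FE mulr_suml.
elim/big_ind2: _ => [|u a v b ua vb|k _]; first by rewrite hnorm0.
  by apply: le_trans (Defs.hnormD _ _) _; exact: lerD.
apply: le_trans (hnorm_scale_le _ _) _; rewrite -mulrA.
apply: ler_wpM2l; first exact: cnorm_ge0.
apply: le_trans (hnorm_scale_le _ _) _.
have -> : 4 * hnorm (x k) * hnorm (y k) * hnorm f =
  4 * hnorm f * hnorm (x k) * hnorm (y k) by ring.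
by apply: ler_wpM2r; rewrite ?hnorm_ge0 // cnorm_inner_le.
Qed.

End HilbertNorm.

(** * Finite orthonormal expansions and real multipliers *)

Section Orthonormal.
Variables (R : realType) (A : cstarAlgType R) (H : hilbertModType A).
Variable e : nat -> H.
Hypothesis e_orth : forall j k, inner (e j) (e k) = (j == k)%:R :> A.

Lemma inner_orthonormal_suml (a : nat -> A) m n j :
  inner (\sum_(m <= k < n) a k *: e k) (e j) =
  if (m <= j < n)%N then a j else 0.
Proof.
rewrite inner_suml; under eq_bigr do rewrite innerZl e_orth mulr_natr mulrb.
by rewrite -big_mkcond /= big_nat1_eq.
Qed.

Lemma inner_orthonormal_sum (a b : nat -> A) m n :
  inner (\sum_(m <= k < n) a k *: e k) (\sum_(m <= k < n) b k *: e k) =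
  \sum_(m <= k < n) a k * star (b k).
Proof.
rewrite inner_suml big_nat [RHS]big_nat; apply: eq_bigr => k kmn.
by rewrite innerZl inner_star inner_orthonormal_suml kmn.
Qed.

(* [b k] is the mean of the scalars [z k] and [conj (z k)] of modulus [M], and
   multiplying the coefficients by scalars of modulus [M] scales the norm by [M]. *)
Lemma hnorm_multiplier_le (M : R) (b : nat -> R) (a : nat -> A) m n :
  (forall k, `|b k| <= M) ->
  hnorm (\sum_(m <= k < n) ((b k)%:C *: a k) *: e k) <=
    M * hnorm (\sum_(m <= k < n) a k *: e k).
Proof.
move=> b_le; have M_ge0 : 0 <= M by apply: le_trans (b_le 0%N).
set z : nat -> R[i] := fun k => (b k +i* Num.sqrt (M ^+ 2 - b k ^+ 2))%C.
have zE k : z k * (z k)^*%C = (M ^+ 2)%:C.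
  have := b_le k; rewrite ler_norml => /andP[b1 b2].
  rewrite /z /= ; simpc; congr (_ +i* _)%C; last by ring.
  rewrite -!expr2 sqr_sqrtr; first by ring.
  by rewrite subr_ge0; nra.
have norm_z (w : nat -> R[i]) : (forall k, w k * (w k)^*%C = (M ^+ 2)%:C) ->
    hnorm (\sum_(m <= k < n) (w k *: a k) *: e k) =
    M * hnorm (\sum_(m <= k < n) a k *: e k).
  move=> wE; apply: hnorm_proportional => //; rewrite !inner_orthonormal_sum.
  rewrite scaler_sumr; apply: eq_bigr => k _.
  by rewrite starZ -scalerAl -scalerAr scalerA wE.
set x := \sum_(_ <= k < _) _.
have := Defs.hnormD (\sum_(m <= k < n) (z k *: a k) *: e k)
  (\sum_(m <= k < n) ((z k)^*%C *: a k) *: e k).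
rewrite (norm_z z zE) (norm_z (fun k => (z k)^*%C)); last first.
  by move=> k; rewrite conjcK mulrC.
rewrite (_ : _ + _ = hscale (2 : R)%:C x).
  by rewrite hnorm_hscale ger0_norm //; lra.
rewrite -big_split /= /x /hscale scaler_sumr; apply: eq_bigr => k _.
rewrite -scalerDl -scalerDl scalerA mulr_algl scalerA; congr (_ *: _ *: _).
by rewrite addcJ rmorph_nat.
Qed.

End Orthonormal.

(** * The frame inequalities *)

Unset Implicit Arguments.
Set Strict Implicit.

Theorem theorem3p1 (R : realType) (A : cstarAlgType R) (H : hilbertModType A)
  (T : {linear H -> H}) (alpha : nat -> R) (e f_ : nat -> H)
  (xi : R) (S : H -> H) :
  countably_generated H ->
  compact_op T ->
  selfadj_op T ->
  orthonormal_basis e ->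
  (forall k, eigenvector T (e k)) ->
  (forall f : H,
     series_to (fun k => hscale (alpha k)%:C (inner f (e k) *: e k)) (T f)) ->
  bessel_seq f_ ->
  0 < xi ->
  (forall f : H, series_to (fun k => inner f (f_ k) *: f_ k) (S f)) ->
  (forall f : H, S f = T f + hscale xi%:C f) ->
  0 < inf (range alpha) + xi ->
  frame f_.
Proof.
move=> _ cT _ [e_orth e_basis] _ T_series [B B_gt0 bessel] _ S_series SE inf_gt0.
have [C C_ge0 T_le] := compact_op_bounded cT.
have ee k : inner (e k) (e k) = 1 by rewrite e_orth eqxx.
have hnorm_e k : hnorm (e k) = 1 by rewrite hnormE ee cnorm1 sqrtr1.
(* Testing the bound of [T] on the unit vector [e k] bounds its eigenvalue. *)
have alpha_le k : `|alpha k| <= C.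
  have TeE : T (e k) = hscale (alpha k)%:C (e k).
    apply: hnorm_cvg_unique (T_series (e k)) _.
    (* The n-th partial sum runs over indices below n, so it contains the only nonzero term, and is
       constant, from [k.+1] on. *)
    apply: cvg_near_cst; exists k.+1 => // n /= kn.
    rewrite (_ : series _ n = hscale (alpha k)%:C (e k)) ?subrr ?hnorm0 //.
    rewrite /series /= (bigD1_seq k) ?iota_uniq ?mem_index_iota //= ee scale1r.
    rewrite big1 ?addr0 // => j /negPf jk.
    by rewrite e_orth eq_sym jk scale0r /hscale scaler0.
  by have := T_le (e k); rewrite TeE hnorm_hscale hnorm_e !mulr1.
set m := inf (range alpha).
have m_le k : m <= alpha k.
  (* On a set unbounded below [inf] takes the default value 0; the bound [- C] makes it a genuine
     infimum here. *)
  apply: ge_inf; last by exists k.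
  by exists (- C) => _ [j _ <-]; have := alpha_le j; rewrite ler_norml => /andP[].
pose beta k := Num.sqrt (alpha k - m).
(* The added 1 keeps [M] positive even when [C = m], as the division of [eps] by [M] requires. *)
pose M := Num.sqrt (C - m) + 1.
have M_gt0 : 0 < M by rewrite ltr_wpDl ?sqrtr_ge0.
have beta_le k : `|beta k| <= M.
  rewrite ger0_norm ?sqrtr_ge0 // ler_wpDr // ler_wsqrtr // lerB //.
  exact: le_trans (ler_norm _) (alpha_le k).
(* The upper bound is the Bessel bound itself; only the lower inequality remains to be shown. *)
exists (m + xi), B; split => // f.
have [s fs s_le] := bessel f; exists s; split => //.
have sE : s = inner (S f) f.
  apply: cnorm_cvg_unique fs _.
  have := inner_cvg (S_series f) (hnorm_cvg_cst f).
  congr norm_cvg; apply/funext => n; rewrite /series /= inner_suml.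
  by apply: eq_bigr => k _; rewrite innerZl.
have [s_sa _ _] := s_le.
have ff_sa : selfadj ((m + xi)%:C *: inner f f).
  by rewrite /selfadj starZ conjc_real -inner_star.
split => //.
have [r rP] : exists r, series_to (fun k => ((beta k)%:C *: inner f (e k)) *: e k) r.
  (* Each block of this series has norm at most [M] times the same block of the expansion of [f],
     which is Cauchy. *)
  apply: series_to_complete => eps eps_gt0.
  have [|N hN] := series_cvg_cauchy (e_basis f) (eps := eps / M).
    by rewrite divr_gt0.
  exists N => a b Na ab; apply: le_lt_trans (hnorm_multiplier_le e_orth _ _ _ beta_le) _.
  by rewrite mulrC -ltr_pdivlMr // hN.
have -> : s - (m + xi)%:C *: inner f f = inner r r; last exact: inner_pos.
have -> : s - (m + xi)%:C *: inner f f = inner (T f - hscale m%:C f) f.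
  rewrite sE SE innerDl innerBl !inner_hscalel rmorphD scalerDl.
  by rewrite opprD addrA addrAC addrK.
(* Both sides are limits of the same partial sums: with a = ⟨f, e k⟩, the k-th terms agree because
   (α k - m) a a* = (β k a)(β k a)*, using [m_le] for the square root. *)
apply: cnorm_cvg_unique (inner_cvg (hnorm_cvgB_hscale m (T_series f) (e_basis f))
  (hnorm_cvg_cst f)) _.
have := inner_cvg rP rP; congr norm_cvg; apply/funext => n.
rewrite /series /= inner_orthonormal_sum // /hscale scaler_sumr -sumrB inner_suml.
apply: eq_bigr => k _.
rewrite innerBl -/(hscale _ _) -/(hscale m%:C _) !inner_hscalel !innerZl.
rewrite -scalerBl starZ conjc_real -scalerAl -scalerAr scalerA -inner_star.
by rewrite -rmorphM -expr2 sqr_sqrtr ?subr_ge0 // rmorphB.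
Qed.
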